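(* Let $\mathcal{C}=\bigcup_{n\ge 1}\mathcal{C}(\mathbb{T}^n)$ be a Boyd--Lawton collection of functions, let $n\ge 1$, and let $g\in\mathcal{C}(\mathbb{T}^n)$. Then $$\int_{\mathbb{T}^n} g\,d\tau_n=\lim_{\mu(q_A)\to\infty}\int_{\mathbb{T}^m} g\circ q_A\,d\tau_m,$$ where $q_A\colon\mathbb{T}^m\to\mathbb{T}^n$ varies among continuous homomorphisms; here $m$ may vary in the limit, but $n$ is fixed by the choice of $g$. Explicitly: for every $\varepsilon>0$ there is a real bound $M$ such that for every positive integer $m$ and every continuous homomorphism $q_A\colon\mathbb{T}^m\to\mathbb{T}^n$ with $\mu(q_A)\ge M$, $$\left|\int_{\mathbb{T}^n} g\,d\tau_n-\int_{\mathbb{T}^m} g\circ q_A\,d\tau_m\right|<\varepsilon .$$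
   Context: $\mathbb{T}$ is the unit circle in $\mathbb{C}$; $\mathbb{T}^n=\{(z_1,\dots,z_n)\in\mathbb{C}^n: |z_1|=\dots=|z_n|=1\}$ is a compact group under coordinatewise multiplication, with normalized Haar measure $\tau_n$ (total mass 1); $\tau=\tau_1$. For an $n\times m$ integer matrix $A=(a_{ij})$, $q_A\colon\mathbb{T}^m\to\mathbb{T}^n$ is the continuous homomorphism $q_A(z_1,\dots,z_m)=(z_1^{a_{11}}z_2^{a_{12}}\cdots z_m^{a_{1m}},\dots,z_1^{a_{n1}}z_2^{a_{n2}}\cdots z_m^{a_{nm}})$. Every continuous homomorphism $\mathbb{T}^m\to\mathbb{T}^n$ is $q_A$ for a unique such $A$. A vector $\mathbf{r}\in\mathbb{Z}^n$ is viewed as an $n\times1$ matrix, so $q_{\mathbf{r}}\colon\mathbb{T}\to\mathbb{T}^n$, $q_{\mathbf r}(z)=(z^{r_1},\dots,z^{r_n})$. The Boyd height is $\mu(q_A)=\mu(A)=\min\{\|\mathbf{v}\|_\infty:\mathbf{v}\in\mathbb{Z}^n,\ \mathbf{v}\ne\mathbf{0},\ \mathbf{v}\cdot A=\mathbf{0}\}$ ($\mathbf v$ a row vector, $\|\mathbf v\|_\infty$ the largest absolute value of a coordinate), and $\mu(q_A)=\infty$ if no such $\mathbf{v}$ exists. A Boyd--Lawton collection $\mathcal{C}=\bigcup_{n\ge1}\mathcal{C}(\mathbb{T}^n)$ is a collection of functions such that: (1) If $g\in\mathcal{C}(\mathbb{T}^n)$ then $g$ is defined and complex-valued almost everywhere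 on $\mathbb{T}^n$ and is integrable (it gives an element of $L^1(\mathbb{T}^n)$). (2) For each $g\in\mathcal{C}(\mathbb{T}^n)$ with $n\ge2$, $\int_{\mathbb{T}^n}g\,d\tau_n=\lim_{\mu(q_{\mathbf r})\to\infty}\int_{\mathbb{T}}g\circ q_{\mathbf r}\,d\tau$, where $q_{\mathbf r}\colon\mathbb{T}\to\mathbb{T}^n$ varies over the homomorphisms given by $\mathbf r\in\mathbb{Z}^n$ (implicit: for all large enough $\mu(q_{\mathbf r})$ the function $g\circ q_{\mathbf r}$ is integrable). (3) If $g\in\mathcal{C}(\mathbb{T}^n)$, there is a bound $B$ such that for every $m\ge1$ and every $q_A\colon\mathbb{T}^m\to\mathbb{T}^n$ with $\mu(q_A)\ge B$, the composition $g\circ q_A$ is in $\mathcal{C}(\mathbb{T}^m)$. Functions are actual (partially defined) functions, not almost-everywhere classes; $g\circ q_A$ is defined at the points that $q_A$ maps into the domain of $g$. The case $\mu(q_A)=\infty$ counts as satisfying $\mu(q_A)\ge M$ for every real $M$. *)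

(* Defs.v *)
From HB Require Import structures.
From mathcomp Require Import all_boot all_order all_algebra.
From mathcomp Require Import complex.
From mathcomp Require Import all_classical all_reals all_analysis.

Set Implicit Arguments.
Unset Strict Implicit.
Unset Printing Implicit Defensive.

Import Order.TTheory GRing.Theory Num.Theory numFieldNormedType.Exports.

Local Open Scope classical_set_scope.
Local Open Scope ring_scope.
Local Open Scope complex_scope.

(* [R[i]^o] is [R[i]] with the topology of its norm; [torus R n] receives the
   subspace topology from [C^n]. *)
Definition torus_set (R : realType) (n : nat) : set 'rV[R[i]^o]_n :=
  [set z | forall j, `|z 0 j : R[i]| = 1].
Arguments torus_set : clear implicits.

Definition torus (R : realType) (n : nat) : Type := set_type (torus_set R n).

Lemma torus_one_subproof (R : realType) (n : nat) :
  (const_mx 1 : 'rV[R[i]^o]_n) \in torus_set R n.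
Proof. by apply/mem_set => j; rewrite mxE normr1. Qed.

HB.instance Definition _ (R : realType) (n : nat) :=
  Topological.copy (torus R n) (set_type (torus_set R n)).

HB.instance Definition _ (R : realType) (n : nat) :=
  isPointed.Build (torus R n)
    (exist (fun w => w \in torus_set R n) _ (torus_one_subproof R n)).

Definition tcoord (R : realType) (n : nat) (z : torus R n) (j : 'I_n) : R[i] :=
  set_val z 0 j.

Lemma norm_tcoord (R : realType) (n : nat) (z : torus R n) (j : 'I_n) :
  `|tcoord z j| = 1.
Proof. by rewrite /tcoord; have := set_mem (valP z); exact. Qed.

Lemma torus_mul_subproof (R : realType) (n : nat) (a z : torus R n) :
  (\row_j (tcoord a j * tcoord z j) : 'rV[R[i]^o]_n) \in torus_set R n.
Proof. by apply/mem_set => j; rewrite mxE normrM !norm_tcoord mulr1. Qed.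

Definition torus_mul (R : realType) (n : nat) (a z : torus R n) : torus R n :=
  exist (fun w => w \in torus_set R n) _ (torus_mul_subproof a z).

Lemma torus_hom_subproof (R : realType) (n m : nat) (A : 'M[int]_(n, m))
    (z : torus R m) :
  (\row_i (\prod_j tcoord z j ^ A i j) : 'rV[R[i]^o]_n) \in torus_set R n.
Proof.
apply/mem_set => i; rewrite mxE normr_prod big1// => j _.
by case: (A i j) => k; rewrite /exprz ?normfV normrX norm_tcoord expr1n ?invr1.
Qed.

Definition torus_hom (R : realType) (n m : nat) (A : 'M[int]_(n, m))
    (z : torus R m) : torus R n :=
  exist (fun w => w \in torus_set R n) _ (torus_hom_subproof A z).

Definition borel_torus (R : realType) (n : nat) : measurableType _ :=
  g_sigma_algebraType (@open (torus R n)).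

(* A normalized Haar measure is a translation-invariant Borel probability;
   regularity is automatic, [T^n] being compact and metrizable. *)
Definition is_haar (R : realType) (n : nat)
    (tau : probability (borel_torus R n) R) :=
  forall (a : torus R n) (U : set (borel_torus R n)), measurable U ->
    tau (torus_mul a @` U) = tau U.

(* [None] marks the points where the function is undefined. *)
Definition pfun_torus (R : realType) (n : nat) := torus R n -> option R[i].

(* [h] is an everywhere defined Borel function representing the class of [g]
   in [L^1]. As [g] itself need not be Borel, but only equal almost everywhere
   to [h], this also covers Lebesgue measurable functions. *)
Definition L1_repr (R : realType) (n : nat)
    (tau : probability (borel_torus R n) R) (g : pfun_torus R n)
    (h : borel_torus R n -> R[i]) :=
  [/\ tau.-integrable setT (fun z => (complex.Re (h z))%:E),
      tau.-integrable setT (fun z => (complex.Im (h z))%:E) &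
      {ae tau, forall z, g z = Some (h z)}].

Definition pintegrable (R : realType) (n : nat)
    (tau : probability (borel_torus R n) R) (g : pfun_torus R n) :=
  exists h, L1_repr tau g h.

Definition cintegral (R : realType) (n : nat)
    (tau : probability (borel_torus R n) R) (h : borel_torus R n -> R[i]) :
    R[i] :=
  Rintegral tau setT (fun z => complex.Re (h z)) +i*
  Rintegral tau setT (fun z => complex.Im (h z)).

Definition pintegral (R : realType) (n : nat)
    (tau : probability (borel_torus R n) R) (g : pfun_torus R n) : R[i] :=
  cintegral tau (xget (fun=> 0) (L1_repr tau g)).

Lemma pintegralE (R : realType) (n : nat)
    (tau : probability (borel_torus R n) R) (g : pfun_torus R n)
    (h : borel_torus R n -> R[i]) :
  L1_repr tau g h -> pintegral tau g = cintegral tau h.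
Proof.
move=> gh; rewrite /pintegral; set k := xget _ _.
have [iRk iIk gk] : L1_repr tau g k by exact: (xgetPex (fun=> 0) (ex_intro _ h gh)).
have [iRh iIh gh'] := gh; rewrite /cintegral /Rintegral.
have FF := ae_filter_ringOfSetsType tau.
have kh : \forall z \near almost_everywhere tau, k z = h z.
  by apply: filterS2 gk gh' => z -> [].
congr (fine _ +i* fine _); apply: ae_eq_integral => //.
- exact: measurable_int iRk.
- exact: measurable_int iRh.
- by apply: filterS kh => z /= ->.
- exact: measurable_int iIk.
- exact: measurable_int iIh.
- by apply: filterS kh => z /= ->.
Qed.

(* [`|v|] is the maximum norm of the row vector [v]. The infimum is over a set
   of natural numbers, hence a minimum, and is [+oo] if the set is empty. *)
Definition boyd_height (R : realType) (n m : nat) (A : 'M[int]_(n, m)) :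
    \bar R :=
  ereal_inf [set (`|v|%:~R)%:E |
    v in [set v : 'rV[int]_n | v != 0 /\ v *m A = 0]].

Record boyd_lawton (R : realType)
    (tau : forall n, probability (borel_torus R n) R)
    (C : forall n, set (pfun_torus R n)) : Prop := BoydLawton {
  boyd_lawton_L1 : forall (n : nat) (g : pfun_torus R n), (0 < n)%N -> C n g ->
    pintegrable (tau n) g ;
  boyd_lawton_lim : forall (n : nat) (g : pfun_torus R n), (1 < n)%N -> C n g ->
    forall e : R, 0 < e -> exists M : R, forall r : 'cV[int]_n,
      (M%:E <= boyd_height R r)%E ->
      pintegrable (tau 1) (g \o torus_hom r) /\
      `|pintegral (tau n) g - pintegral (tau 1) (g \o torus_hom r)| < e%:C ;
  boyd_lawton_comp : forall (n : nat) (g : pfun_torus R n), (0 < n)%N -> C n g ->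
    exists B : R, forall (m : nat) (A : 'M[int]_(n, m)), (0 < m)%N ->
      (B%:E <= boyd_height R A)%E -> C m (g \o torus_hom A) }.

(* Main.v *)
Require Import Defs.
From mathcomp Require Import all_boot all_order all_algebra.
From mathcomp Require Import complex.
From mathcomp Require Import all_classical all_reals all_analysis.
From mathcomp Require Import measurable_realfun zify lra.

Set Implicit Arguments.
Unset Strict Implicit.
Unset Printing Implicit Defensive.

Import Order.TTheory GRing.Theory Num.Theory numFieldNormedType.Exports.

Local Open Scope classical_set_scope.
Local Open Scope ring_scope.
Local Open Scope complex_scope.

(** Let [2 <= n], and let [A] have large height. Then [g \o q_A] belongs to
the collection, so both integrals are limits of integrals over the circle: the
one of [g] along vectors [r] of large height, the one of [g \o q_A] along
vectors [s] of large height. Since [q_(A *m s) = q_A \o q_s]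
([torus_hom_mulmx]), one and the same circle integral is close to both as soon
as [s] and [A *m s] both have large height, and the theorem follows from the
triangle inequality.

Such an [s] exists for two reasons. If [v] is short and [v *m A != 0], then
[v *m A] is still bounded in terms of [A], so a vector [s] of sufficiently
large height is not orthogonal to it ([boyd_height_mulmx]). And a column of
powers of a large integer [N] has large height, because an integer has at most
one expansion in base [N] with small digits ([digits_eq0],
[exists_height_ge]). If [m = 1], then [A] is itself a vector and the limit
along vectors applies directly.

For [n = 1] no limit is available, but there the two integrals are equal. A
row [A] of height at least [2] is nonzero, since otherwise the vector [1] would
annihilate it; hence [q_A] is onto the circle ([torus_hom_surj]), the image of
the Haar measure of the torus under [q_A] is a translation-invariant
probability, and it is the Haar measure of the circle ([haar_torus_hom]). This
last step is Fubini's theorem for the indicator of [q_A x * y \in U] on the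
product of the torus and the circle; it needs multiplication to be measurable
for the product of the Borel sigma-algebras, which holds because every open
subset of the circle is the trace of a union of countably many boxes with
rational sides ([open_circle_boxes], [measurable_to_circle]). *)

(** * Boyd height *)

Lemma boyd_heightP (R : realType) (n m : nat) (A : 'M[int]_(n, m)) (M : R) :
  (M%:E <= boyd_height R A)%E <->
  (forall v : 'rV[int]_n, v != 0 -> v *m A = 0 -> M <= `|v|%:~R).
Proof.
split => [/ereal_infP + v v0 vA|MA].
  by move=> /(_ (`|v|%:~R)%:E); rewrite lee_fin; apply; exists v.
by apply/ereal_infP => _ [v [v0 vA] <-]; rewrite lee_fin; exact: MA.
Qed.

Lemma normr_row_entry (n : nat) (v : 'rV[int]_n) (j : 'I_n) : `|v 0 j| <= `|v|.
Proof.
rewrite [leRHS]mx_normrE.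
exact: (@le_bigmax _ _ _ 0 (fun ij : 'I_1 * 'I_n => `|v ij.1 ij.2|) (0, j)).
Qed.

Lemma normr_row_le (n : nat) (v : 'rV[int]_n) (K : int) :
  0 <= K -> (forall j, `|v 0 j| <= K) -> `|v| <= K.
Proof.
move=> K0 vK; rewrite [leLHS]mx_normrE.
by apply: bigmax_le => // -[i j] _ /=; rewrite ord1.
Qed.

Lemma normr_mulmx_le (n m : nat) (v : 'rV[int]_n) (A : 'M[int]_(n, m)) :
  `|v *m A| <= `|v| * \sum_i \sum_j `|A i j|.
Proof.
apply: normr_row_le => [|j].
  by rewrite mulr_ge0// sumr_ge0// => i _; rewrite sumr_ge0.
rewrite mxE mulr_sumr (le_trans (ler_norm_sum _ _ _))//.
apply: ler_sum => i _; rewrite normrM ler_pM// ?normr_row_entry//.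
by rewrite (bigD1 j)//= lerDl sumr_ge0.
Qed.

(** Modulo [N] the sum is its lowest digit, which is too small to be a nonzero
multiple of [N]; dividing by [N] moves on to the next digit. *)
Lemma digits_eq0 (m : nat) (N : int) (v : 'I_m -> int) :
  (forall j, `|v j| < N) -> \sum_j v j * N ^+ j = 0 -> forall j, v j = 0.
Proof.
elim: m v => [|m IH] v vN; first by move=> _ [].
rewrite big_ord_recl expr0 mulr1.
under eq_bigr do rewrite lift0 exprS mulrCA.
rewrite -mulr_sumr => v0.
have N0 : N != 0 by have := vN ord0; lia.
have v00 : v ord0 = 0.
  set S := \sum_(i < m) _ in v0.
  have /eqP := v0; rewrite addr_eq0 => /eqP vS.
  have := vN ord0; rewrite {1}vS normrN normrM.
  have [S0|S0] := eqVneq S 0; first by move=> _; rewrite vS S0 mulr0 oppr0.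
  have S1 : 1 <= `|S| by rewrite -gtz0_ge1 normr_gt0.
  by rewrite ltNge (le_trans (ler_norm N))// ler_peMr.
move: v0; rewrite v00 add0r => /eqP; rewrite mulf_eq0 (negPf N0)/= => /eqP S0.
move=> j; case: (unliftP ord0 j) => [i ->|->//].
exact: (IH (fun i => v (lift ord0 i)) (fun i => vN _) S0).
Qed.

(** A short vector orthogonal to the column of powers of [N] is a
representation of [0] in base [N] with small digits. *)
Lemma exists_height_ge (R : realType) (m : nat) (K : R) :
  exists s : 'cV[int]_m, (K%:E <= boyd_height R s)%E.
Proof.
pose N := (Num.truncn `|K|).+1.
exists (\col_j (N%:Z ^+ j)); apply/boyd_heightP => v v0 vs.
rewrite leNgt; apply/negP => vK; move/negP: v0; apply; apply/eqP/rowP => j.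
rewrite [RHS]mxE; move: j; apply: (@digits_eq0 _ N) => [j|].
  apply: le_lt_trans (normr_row_entry _ _) _.
  rewrite -(ltr_int R); apply: lt_trans vK _.
  by apply: le_lt_trans (ler_norm K) _; exact: truncnS_gt.
have /rowP/(_ 0) := vs; rewrite !mxE => vs0; rewrite -[RHS]vs0.
by apply: eq_bigr => j _; rewrite mxE.
Qed.

(** A vector [v] killed by [A *m s] is either killed by [A], and then long
because of [A], or gives a nonzero [v *m A] orthogonal to [s], which is long
because of [s]; in the second case [v] is long as well, as [A] stretches norms
by a bounded factor. *)
Lemma boyd_height_mulmx (R : realType) (n m : nat) (A : 'M[int]_(n, m))
    (s : 'cV[int]_m) (M : R) :
  (M%:E <= boyd_height R A)%E ->
  ((`|M| * (\sum_i \sum_j `|A i j|)%:~R)%:E <= boyd_height R s)%E ->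
  (M%:E <= boyd_height R (A *m s))%E.
Proof.
move=> /boyd_heightP MA /boyd_heightP Ms; apply/boyd_heightP => v v0.
rewrite mulmxA => vAs.
have [vA|vA] := eqVneq (v *m A) 0; first exact: MA.
have := Ms _ vA vAs; set S := \sum_i _ => vAS.
have SvA : `|v *m A| <= `|v| * S by exact: normr_mulmx_le.
have vA0 : 0 < `|v *m A| by rewrite normr_gt0.
have S0 : 0 < S.
  rewrite ltNge; apply/negP => S0; move: vA0; rewrite ltNge => /negP; apply.
  by apply: le_trans SvA _; rewrite mulr_ge0_le0.
apply: (le_trans (ler_norm M)); rewrite -(@ler_pM2r _ S%:~R) ?ltr0z//.
by apply: le_trans vAS _; rewrite -intrM ler_int.
Qed.

(** * The group structure of the torus *)

Lemma torusP (R : realType) (n : nat) (z w : torus R n) :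
  (forall j, tcoord z j = tcoord w j) -> z = w.
Proof.
by move=> zw; apply: val_inj; apply/rowP => j; exact: zw.
Qed.

Lemma tcoord_hom (R : realType) (n m : nat) (A : 'M[int]_(n, m))
    (z : torus R m) (i : 'I_n) :
  tcoord (torus_hom A z) i = \prod_j tcoord z j ^ A i j.
Proof. by rewrite /tcoord /= mxE. Qed.

Lemma tcoord_mul (R : realType) (n : nat) (z w : torus R n) (i : 'I_n) :
  tcoord (torus_mul z w) i = tcoord z i * tcoord w i.
Proof. by rewrite [LHS]mxE. Qed.

Lemma tcoord_neq0 (R : realType) (n : nat) (z : torus R n) (j : 'I_n) :
  tcoord z j != 0.
Proof. by rewrite -normr_eq0 norm_tcoord oner_eq0. Qed.

Lemma prodrXz (F : fieldType) (I : finType) (f : I -> F) (a : int) :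
  (\prod_i f i) ^ a = \prod_i f i ^ a.
Proof.
exact: (big_morph (fun x : F => x ^ a) (fun x y => expfzMl x y a) (exp1rz _ a)).
Qed.

Lemma exprz_sumr (F : fieldType) (I : finType) (x : F) (f : I -> int) :
  x != 0 -> x ^ (\sum_i f i) = \prod_i x ^ f i.
Proof.
move=> x0.
exact: (big_morph (exprz x) (fun a b => expfzDr a b x0) (expr0z x)).
Qed.

Lemma torus_hom_mulmx (R : realType) (n m p : nat) (A : 'M[int]_(n, m))
    (B : 'M[int]_(m, p)) (z : torus R p) :
  torus_hom (A *m B) z = torus_hom A (torus_hom B z).
Proof.
apply: torusP => i; rewrite !tcoord_hom.
under [RHS]eq_bigr do rewrite tcoord_hom prodrXz.
rewrite exchange_big; apply: eq_bigr => k _.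
rewrite mxE exprz_sumr ?tcoord_neq0//.
by apply: eq_bigr => j _; rewrite exprz_exp mulrC.
Qed.

Lemma torus_homM (R : realType) (n m : nat) (A : 'M[int]_(n, m))
    (z w : torus R m) :
  torus_hom A (torus_mul z w) = torus_mul (torus_hom A z) (torus_hom A w).
Proof.
apply: torusP => i; rewrite tcoord_mul !tcoord_hom -big_split.
by apply: eq_bigr => j _; rewrite tcoord_mul expfzMl.
Qed.

(** The inverse of [a] is its image under the homomorphism of matrix
[- 1%:M]. *)
Lemma torus_mul_surj (R : realType) (n : nat) (a z : torus R n) :
  exists w, torus_mul a w = z.
Proof.
exists (torus_mul (torus_hom (- 1%:M) a) z); apply: torusP => i.
rewrite !tcoord_mul tcoord_hom (bigD1 i)//= !mxE eqxx big1 => [|j ji].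
  by rewrite mulr1 exprN1 mulVKf// tcoord_neq0.
by rewrite !mxE eq_sym (negPf ji) oppr0 expr0z.
Qed.

Lemma unimodular_root (R : realType) (k : int) (a : R[i]) :
  k != 0 -> `|a| = 1 -> exists2 w : R[i], `|w| = 1 & w ^ k = a.
Proof.
move=> k0 a1.
have natroot (p : nat) (b : R[i]) : (0 < p)%N -> `|b| = 1 ->
    exists2 w : R[i], `|w| = 1 & w ^+ p = b.
  move=> p0 b1; exists (p.-root b); last by rewrite rootCK.
  by apply/eqP; rewrite -(@pexpr_eq1 _ _ p)// -normrX rootCK// b1.
have k0' : (0 < `|k|)%N by rewrite absz_gt0.
case: k k0 k0' => p pz p0; first exact: natroot.
have [] := natroot p.+1 a^-1 => //; first by rewrite normfV a1 invr1.
by move=> w w1 wp; exists w => //; rewrite NegzE -exprnN wp invrK.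
Qed.

(** One nonzero exponent suffices: take a root in that coordinate and [1] in
the others. *)
Lemma torus_hom_surj (R : realType) (m : nat) (A : 'M[int]_(1, m)) :
  A != 0 -> forall a : torus R 1, exists z : torus R m, torus_hom A z = a.
Proof.
move=> A0 a.
have [j Aj] : exists j, A 0 j != 0.
  apply/existsP; rewrite -negb_forall; apply: contra A0 => /forallP A0.
  by apply/eqP/rowP => j; rewrite mxE; exact/eqP.
have [w w1 wA] := unimodular_root Aj (norm_tcoord a 0).
have zP : (\row_k (if k == j then w else 1) : 'rV[R[i]^o]_m) \in torus_set R m.
  by apply/mem_set => k; rewrite mxE; case: ifP; rewrite ?normr1.
exists (exist (fun w => w \in torus_set R m) _ zP).
apply: torusP => i; rewrite tcoord_hom (ord1 i) (bigD1 j)//= big1 => [|k kj].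
  by rewrite mulr1 /tcoord/= mxE eqxx.
by rewrite /tcoord/= mxE (negPf kj) exp1rz.
Qed.

(** * Measurability on the torus *)

Lemma normc_ge_Im (R : realType) (x : R[i]) : `|complex.Im x|%:C <= `|x|.
Proof.
case: x => a b /=; rewrite normc_def lecR /= -sqrtr_sqr.
by apply: ler_wsqrtr; rewrite lerDr sqr_ge0.
Qed.

Lemma normc_le_ReIm (R : realType) (x : R[i]) :
  `|x| <= (`|complex.Re x| + `|complex.Im x|)%:C.
Proof.
case: x => a b /=; rewrite normc_def lecR /=.
rewrite -[leRHS]ger0_norm ?addr_ge0// -sqrtr_sqr; apply: ler_wsqrtr.
by rewrite sqrrD !real_normK ?num_real// lerD2r lerDl mulrn_wge0// mulr_ge0.
Qed.

Lemma lipschitz_continuous (R : realType) (f : R[i]^o -> R) :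
  (forall x y : R[i], `|f x - f y|%:C <= `|x - y|) -> continuous f.
Proof.
move=> fL x A /nbhs_ballP[e /= e0 eA].
apply/nbhs_ballP; exists e%:C; first by rewrite /= ltcR.
move=> y xy; apply: eA; rewrite /ball/= -ltcR.
by apply: le_lt_trans (fL x y) _.
Qed.

Lemma continuous_Re (R : realType) : continuous (@complex.Re R : R[i]^o -> R).
Proof.
by apply: lipschitz_continuous => x y; rewrite -raddfB; exact: normc_ge_Re.
Qed.

Lemma continuous_Im (R : realType) : continuous (@complex.Im R : R[i]^o -> R).
Proof.
by apply: lipschitz_continuous => x y; rewrite -raddfB; exact: normc_ge_Im.
Qed.

Lemma measurable_fun_continuous (R : realType) (n : nat)
    (f : torus R n -> R) :
  continuous f -> measurable_fun setT (f : borel_torus R n -> R).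
Proof.
move=> cf; apply: (measurability (@RGenOpens.G R)).
  exact: RGenOpens.measurableE.
move=> _ [_ [a [b ->]] <-]; rewrite setTI; apply: sub_sigma_algebra.
by apply: open_comp => [z _|]; [exact: cf|exact: interval_open].
Qed.

(** For the Borel sigma-algebra of the complex plane this is the usual
measurability, expressed on the real line. *)
Definition measurable_complex (R : realType) d (T : measurableType d)
    (f : T -> R[i]) :=
  measurable_fun setT (@complex.Re R \o f) /\
  measurable_fun setT (@complex.Im R \o f).

Lemma measurable_complexM (R : realType) d (T : measurableType d)
    (f g : T -> R[i]) :
  measurable_complex f -> measurable_complex g ->
  measurable_complex (fun x => f x * g x).
Proof.
move=> [rf jf] [rg jg]; split.
- rewrite (_ : _ \o _ = (@complex.Re R \o f) \* (@complex.Re R \o g) \-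
    (@complex.Im R \o f) \* (@complex.Im R \o g)).
    by apply: measurable_funB; exact: measurable_funM.
  by apply/funext => x /=; case: (f x) (g x) => ? ? [].
- rewrite (_ : _ \o _ = (@complex.Re R \o f) \* (@complex.Im R \o g) \+
    (@complex.Im R \o f) \* (@complex.Re R \o g)).
    by apply: measurable_funD; exact: measurable_funM.
  by apply/funext => x /=; case: (f x) (g x) => ? ? [].
Qed.

Lemma measurable_complex1 (R : realType) d (T : measurableType d) :
  measurable_complex ((fun=> 1) : T -> R[i]).
Proof. by split; exact: measurable_cst. Qed.

Lemma measurable_complexJ (R : realType) d (T : measurableType d)
    (f : T -> R[i]) :
  measurable_complex f -> measurable_complex (fun x => (f x)^*%C).
Proof.
move=> [rf jf]; split.
- rewrite (_ : _ \o _ = @complex.Re R \o f)//.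
  by apply/funext => x /=; case: (f x).
- rewrite (_ : _ \o _ = \- (@complex.Im R \o f)); first exact: measurable_funN.
  by apply/funext => x /=; case: (f x).
Qed.

Lemma measurable_complex_prod (R : realType) d (T : measurableType d)
    (I : Type) (r : seq I) (f : I -> T -> R[i]) :
  (forall i, measurable_complex (f i)) ->
  measurable_complex (fun x => \prod_(i <- r) f i x).
Proof.
move=> mf; elim: r => [|i r IH].
  under eq_fun do rewrite big_nil; exact: measurable_complex1.
under eq_fun do rewrite big_cons; exact: measurable_complexM.
Qed.

Lemma measurable_complexXz (R : realType) d (T : measurableType d)
    (f : T -> R[i]) (k : int) :
  (forall x, `|f x| = 1) -> measurable_complex f ->
  measurable_complex (fun x => f x ^ k).
Proof.
move=> f1 mf.
have mX p : measurable_complex (fun x => f x ^+ p).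
  elim: p => [|p IH]; first exact: measurable_complex1.
  by under eq_fun do rewrite exprS; exact: measurable_complexM.
case: k => p; first exact: mX.
(* On the unit circle the inverse is the conjugate. *)
rewrite (_ : (fun=> _) = fun x => (f x ^+ p.+1)^*%C).
  exact: measurable_complexJ.
apply/funext => x; rewrite NegzE -exprnN invc_norm normrX f1 expr1n.
by rewrite expr1n invr1 mul1r.
Qed.

Lemma measurable_tcoord (R : realType) (n : nat) (j : 'I_n) :
  measurable_complex (fun z : borel_torus R n => tcoord z j).
Proof.
have cj : continuous (fun z : torus R n => tcoord z j : R[i]^o).
  move=> z; apply: (@continuous_comp _ _ _ (@set_val _ (torus_set R n))
    (fun w : 'rV[R[i]^o]_n => w 0 j)); first exact: initial_continuous.
  exact: coord_continuous.
split; apply: measurable_fun_continuous => z.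
- by apply: continuous_comp (cj z) _; exact: continuous_Re.
- by apply: continuous_comp (cj z) _; exact: continuous_Im.
Qed.

Definition box (R : realType) (q : (rat * rat) * (rat * rat)) : set R[i] :=
  [set x | (complex.Re x \in `]ratr q.1.1, ratr q.1.2[) /\
           (complex.Im x \in `]ratr q.2.1, ratr q.2.2[)].

Lemma measurable_box (R : realType) d (T : measurableType d)
    (f : T -> R[i]) q :
  measurable_complex f -> measurable (f @^-1` box q).
Proof.
move=> [rf jf]; rewrite (_ : _ @^-1` _ =
  (@complex.Re R \o f) @^-1` `]ratr q.1.1, ratr q.1.2[%classic `&`
  (@complex.Im R \o f) @^-1` `]ratr q.2.1, ratr q.2.2[%classic)//.
by apply: measurableI; rewrite -[X in measurable X]setTI; [apply: rf|apply: jf].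
Qed.

Lemma rat_around (R : realType) (x e : R) : 0 < e ->
  exists q : rat * rat, (x \in `]ratr q.1, ratr q.2[) /\
    forall y, (y \in `]ratr q.1, ratr q.2[) -> `|x - y| < e.
Proof.
move=> e0.
have [p] : exists p : rat, ratr p \in `]x - e / 2, x[.
  by apply: rat_in_itvoo; lra.
have [q] : exists q : rat, ratr q \in `]x, x + e / 2[.
  by apply: rat_in_itvoo; lra.
rewrite !in_itv/= => /andP[q1 q2] /andP[p1 p2]; exists (p, q); split.
  by rewrite in_itv/= p2.
by move=> y; rewrite in_itv/= => /andP[y1 y2]; rewrite ltr_norml; lra.
Qed.

Lemma box_around (R : realType) (x : R[i]) (e : R) : 0 < e ->
  exists q, box q x /\ forall y, box q y -> `|x - y| < e%:C.
Proof.
move=> e0; have e20 : 0 < e / 2 by lra.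
have [p [px pe]] := rat_around (complex.Re x) e20.
have [q [qx qe]] := rat_around (complex.Im x) e20.
exists (p, q); split=> // y [py qy].
apply: le_lt_trans (normc_le_ReIm _) _; rewrite ltcR !raddfB /=.
by have := pe _ py; have := qe _ qy; lra.
Qed.

(** The union is over a countable set, as the boxes have rational sides; this
is how second countability of the circle enters. *)
Lemma open_circle_boxes (R : realType) (U : set (torus R 1)) : open U ->
  U = \bigcup_(q in [set q | (fun z => tcoord z 0) @^-1` box q `<=` U])
    (fun z => tcoord z 0) @^-1` box q.
Proof.
move=> [V oV <-]; apply/seteqP; split=> [z Vz|z [q qV zq]]; last exact: qV.
have /nbhs_ballP[e /= e0 eV] : nbhs (set_val z) V by exact: open_nbhs_nbhs.
have eE : (complex.Re e)%:C = e by apply: RRe_real; exact: gtr0_real.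
have [q [zq qe]] : exists q, box q (tcoord z 0) /\
    forall y, box q y -> `|tcoord z 0 - y| < (complex.Re e)%:C.
  by apply: box_around; rewrite -ltcR eE.
exists q => //= w wq; apply: eV; split => // i j.
by rewrite !ord1 /ball/= -eE; exact: qe.
Qed.

(** Only countably many conditions on the real and imaginary parts decide
whether a point falls in an open set, so the source may carry any
sigma-algebra, in particular a product of Borel sigma-algebras. *)
Lemma measurable_to_circle (R : realType) d (T : measurableType d)
    (f : T -> borel_torus R 1) :
  measurable_complex (fun x => tcoord (f x) 0) -> measurable_fun setT f.
Proof.
move=> mf.
apply: (measurability (rT := borel_torus R 1) (@open (torus R 1))) => //.
move=> _ [U oU <-]; rewrite setTI (open_circle_boxes oU) preimage_bigcup.
rewrite bigcup_mkcond; apply: countable_bigcupT_measurable => // q.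
by case: ifP => // _; exact: (measurable_box (f := fun x => tcoord (f x) 0)).
Qed.

Lemma measurable_torus_hom (R : realType) (m : nat) (A : 'M[int]_(1, m)) :
  measurable_fun setT (torus_hom A : borel_torus R m -> borel_torus R 1).
Proof.
apply: measurable_to_circle.
under eq_fun do rewrite tcoord_hom.
apply: measurable_complex_prod => j; apply: measurable_complexXz.
  by move=> z; exact: norm_tcoord.
exact: measurable_tcoord.
Qed.

Lemma measurable_complex_comp (R : realType) d d' (T : measurableType d)
    (T' : measurableType d') (f : T' -> R[i]) (g : T -> T') :
  measurable_fun setT g -> measurable_complex f -> measurable_complex (f \o g).
Proof.
move=> mg [rf jf]; split; first exact: (measurableT_comp rf mg).
exact: (measurableT_comp jf mg).
Qed.

Lemma measurable_circle_mul (R : realType) d (T : measurableType d)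
    (f g : T -> borel_torus R 1) :
  measurable_fun setT f -> measurable_fun setT g ->
  measurable_fun setT (fun x => torus_mul (f x) (g x) : borel_torus R 1).
Proof.
move=> mf mg; apply: measurable_to_circle.
under eq_fun do rewrite tcoord_mul.
apply: measurable_complexM.
  exact: measurable_complex_comp mf (measurable_tcoord R 0).
exact: measurable_complex_comp mg (measurable_tcoord R 0).
Qed.

(** * Haar measure and surjections onto the circle *)

(** Invariance under preimages is the form that sections of a product set
call for. *)
Lemma haar_preimage (R : realType) (n : nat)
    (tau : probability (borel_torus R n) R) (a : torus R n)
    (U : set (borel_torus R n)) :
  is_haar tau ->
  measurable (torus_mul a @^-1` U : set (borel_torus R n)) ->
  tau (torus_mul a @^-1` U) = tau U.
Proof.
move=> tauH mU; rewrite -(tauH a _ mU); congr (tau _).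
apply/seteqP; split=> [_ [z Uz <-]//|z Uz].
by have [w wz] := torus_mul_surj a z; exists w => //=; rewrite wz.
Qed.

(** Integrate the indicator of [q_A x * y \in U] in both orders. For fixed
[x], invariance of [tau1] gives [tau1 U]. For fixed [y = q_A b], it is the
indicator of [q_A (b * x) \in U], and invariance of [tau] gives
[tau (q_A @^-1` U)]. *)
Lemma haar_torus_hom (R : realType) (m : nat) (A : 'M[int]_(1, m))
    (tau : probability (borel_torus R m) R)
    (tau1 : probability (borel_torus R 1) R) :
  is_haar tau -> is_haar tau1 -> A != 0 ->
  forall U : set (borel_torus R 1), measurable U ->
    tau (torus_hom A @^-1` U) = tau1 U.
Proof.
move=> tauH tau1H A0 U mU.
pose f (z : borel_torus R m * borel_torus R 1) : borel_torus R 1 :=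
  torus_mul (torus_hom A z.1) z.2.
have mA := @measurable_torus_hom R m A.
have mf : measurable_fun setT f.
  apply: measurable_circle_mul; last exact: measurable_snd.
  by apply: measurableT_comp => //; exact: measurable_fst.
have mx x : measurable ((fun y => f (x, y)) @^-1` U).
  rewrite -[X in measurable X]setTI.
  exact: (measurableT_comp mf (pair1_measurable x)).
have my y : measurable ((fun x => f (x, y)) @^-1` U).
  rewrite -[X in measurable X]setTI.
  exact: (measurableT_comp mf (pair2_measurable y)).
have := @fubini_tonelli _ _ _ _ R tau tau1 (fun z => (\1_(f @^-1` U) z)%:E).
have -> : (fun x => \int[tau1]_y (\1_(f @^-1` U) (x, y))%:E)%E = cst (tau1 U).
  apply/funext => x; rewrite (_ : (fun y => _) =
    fun y => (\1_((fun y => f (x, y)) @^-1` U) y)%:E)//.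
  rewrite integral_indic// setIT.
  by rewrite -(haar_preimage (a := torus_hom A x) tau1H (mx x)).
have -> : (fun y => \int[tau]_x (\1_(f @^-1` U) (x, y))%:E)%E =
    cst (tau (torus_hom A @^-1` U)).
  apply/funext => y; rewrite (_ : (fun x => _) =
    fun x => (\1_((fun x => f (x, y)) @^-1` U) x)%:E)//.
  rewrite integral_indic// setIT /f/=.
  (* Translation by [y] downstairs is translation by [b] upstairs. *)
  have [b bA] := torus_hom_surj A0 y.
  have E : (fun x => torus_mul (torus_hom A x) y) @^-1` U =
      torus_mul b @^-1` (torus_hom A @^-1` U).
    apply/funext => x /=; rewrite torus_homM bA; congr (U _).
    by apply: torusP => i; rewrite !tcoord_mul mulrC.
  by rewrite E; apply: haar_preimage => //; rewrite -E; exact: my.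
have mulT d (T : measurableType d) (P : probability T R) a : (a * P setT = a)%E.
  by rewrite probability_setT mule1.
rewrite !integral_cst// => fubini.
apply: etrans (etrans (esym (fubini _ _)) _); [exact/esym/mulT| | |exact: mulT].
- apply/measurable_EFinP/measurable_indic.
  by rewrite -[X in measurable X]setTI; exact: mf.
- by move=> z; rewrite lee_fin indicE.
Qed.

Lemma integrable_torus_hom (R : realType) (m : nat) (A : 'M[int]_(1, m))
    (tau : probability (borel_torus R m) R)
    (tau1 : probability (borel_torus R 1) R) (h : borel_torus R 1 -> R) :
  is_haar tau -> is_haar tau1 -> A != 0 ->
  tau1.-integrable setT (EFin \o h) ->
  tau.-integrable setT (EFin \o (h \o torus_hom A)) /\
  Rintegral tau setT (h \o torus_hom A) = Rintegral tau1 setT h.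
Proof.
move=> tauH tau1H A0 ih.
pose q : borel_torus R m -> borel_torus R 1 := torus_hom A.
have mq : measurable_fun setT q by exact: measurable_torus_hom.
have mh := measurable_int _ ih.
have pE (U : set (borel_torus R 1)) : measurable U ->
  pushforward tau q U = tau1 U by exact: haar_torus_hom.
have iAh : tau.-integrable setT (EFin \o (h \o torus_hom A)).
  apply/integrableP; split; first exact: (measurableT_comp mh mq).
  have /integrableP[_] := ih; apply: le_lt_trans.
  rewrite -[X in (_ <= X)%E](@eq_measure_integral _ _ _ _ _ (pushforward tau q)).
    rewrite (ge0_integral_pushforward mq)//.
    exact: measurableT_comp.
  by move=> U mU _; exact: pE.
split=> //; rewrite /Rintegral; congr fine.
rewrite -[RHS](@eq_measure_integral _ _ _ _ _ (pushforward tau q)).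
  by rewrite (integral_pushforward mq).
by move=> U mU _; exact: pE.
Qed.

Lemma L1_repr_torus_hom (R : realType) (m : nat) (A : 'M[int]_(1, m))
    (tau : probability (borel_torus R m) R)
    (tau1 : probability (borel_torus R 1) R) (g : pfun_torus R 1)
    (h : borel_torus R 1 -> R[i]) :
  is_haar tau -> is_haar tau1 -> A != 0 -> L1_repr tau1 g h ->
  L1_repr tau (g \o torus_hom A) (h \o torus_hom A) /\
  cintegral tau (h \o torus_hom A) = cintegral tau1 h.
Proof.
move=> tauH tau1H A0 [iR iI [N [mN N0 gN]]].
have [iR' eR] := integrable_torus_hom tauH tau1H A0 iR.
have [iI' eI] := integrable_torus_hom tauH tau1H A0 iI.
split; last by rewrite /cintegral -eR -eI.
split=> //; exists (torus_hom A @^-1` N); split.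
- by rewrite -[X in measurable X]setTI; exact: measurable_torus_hom.
- by rewrite (haar_torus_hom tauH tau1H A0).
- by move=> z /= ghz; apply: gN.
Qed.

(** * The limit over all homomorphisms *)

Theorem theorem1p2 (R : realType)
    (tau : forall n : nat, probability (borel_torus R n) R)
    (tau_haar : forall n : nat, is_haar (tau n))
    (C : forall n : nat, set (pfun_torus R n))
    (C_bl : boyd_lawton tau C)
    (n : nat) (n_gt0 : (0 < n)%N) (g : pfun_torus R n) (Cg : C n g) :
  forall e : R, 0 < e ->
  exists M : R, forall (m : nat) (A : 'M[int]_(n, m)), (0 < m)%N ->
    (M%:E <= boyd_height R A)%E ->
    pintegrable (tau m) (g \o torus_hom A) /\
    `|pintegral (tau n) g - pintegral (tau m) (g \o torus_hom A)| < e%:C.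
Proof.
move=> e e0.
(* On the circle a nonzero exponent row preserves Haar measure. *)
have [n1|n1] := leqP n 1.
  have {n_gt0 n1} n1 : n = 1%N by apply/eqP; rewrite eqn_leq n1.
  move: g Cg; rewrite n1 => g Cg.
  (* The zero row has height [1], so the bound [2] excludes it. *)
  exists 2 => m A m0 /boyd_heightP A2.
  have A0 : A != 0.
    apply/negP => /eqP A0; have := A2 (const_mx 1).
    rewrite A0 mulmx0 => /(_ _ erefl).
    have v1 : `|const_mx 1 : 'rV[int]_1| <= 1.
      by apply: normr_row_le => // j; rewrite mxE.
    have v0 : (const_mx 1 : 'rV[int]_1) != 0.
      by apply/eqP => /rowP/(_ 0); rewrite !mxE.
    move=> /(_ v0); rewrite leNgt => /negP; apply.
    by rewrite (_ : 2 = 2%:~R)// ltr_int; apply: le_lt_trans v1 _.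
  have [h gh] := boyd_lawton_L1 C_bl (ltn0Sn 0) Cg.
  have [ghA hE] := L1_repr_torus_hom (tau_haar m) (tau_haar 1) A0 gh.
  split; first by exists (h \o torus_hom A).
  by rewrite (pintegralE gh) (pintegralE ghA) hE subrr normr0 ltcR.
have e2 : 0 < e / 2 by rewrite divr_gt0.
have [M Mg] := boyd_lawton_lim C_bl n1 Cg e2.
have [B Bg] := boyd_lawton_comp C_bl n_gt0 Cg.
exists (Num.max M B) => m A m0 hA.
have hM : (M%:E <= boyd_height R A)%E.
  by apply: le_trans hA; rewrite lee_fin le_max lexx.
have hB : (B%:E <= boyd_height R A)%E.
  by apply: le_trans hA; rewrite lee_fin le_max lexx orbT.
have CgA := Bg m A m0 hB.
split; first exact (boyd_lawton_L1 C_bl m0 CgA).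
have eE : (e / 2)%:C + (e / 2)%:C = e%:C :> R[i].
  by rewrite -raddfD /= -splitr.
have [m1|m1] := leqP m 1.
  have {m0 m1} m1 : m = 1%N by apply/eqP; rewrite eqn_leq m1.
  move: A hA hM hB CgA; rewrite m1 => A hA hM hB CgA.
  have [_ /lt_le_trans] := Mg A hM; apply.
  by rewrite lecR; lra.
(* [M'] depends on [A], but [s] is chosen after it: the bound [Num.max M B]
   on the height of [A] does not involve [s]. *)
have [M' M'g] := boyd_lawton_lim C_bl m1 CgA e2.
have [s sK] := exists_height_ge m
  (Num.max M' (`|M| * (\sum_i \sum_j `|A i j|)%:~R)).
have sM' : (M'%:E <= boyd_height R s)%E.
  by apply: le_trans sK; rewrite lee_fin le_max lexx.
have AsM : (M%:E <= boyd_height R (A *m s))%E.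
  apply: boyd_height_mulmx => //.
  by apply: le_trans sK; rewrite lee_fin le_max lexx orbT.
have [_ gAs] := M'g s sM'.
have [_] := Mg _ AsM.
have -> : g \o torus_hom (A *m s) = (g \o torus_hom A) \o torus_hom s.
  by apply/funext => z /=; rewrite torus_hom_mulmx.
move=> gs; rewrite -eE; apply: le_lt_trans (ler_distD _ _ _) (ltrD gs _).
by rewrite distrC.
Qed.
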